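(* Let $G=(V,E)$ be a finite directed graph (possibly cyclic) and consider a finite functional causal model on $G$. If the model is not inconsistent, then its distribution $P(\cdot)_G$ (defined from teleportation models, for whichever teleportation graph and teleportation model are used in the definition) is given by $$P(x)_G=\frac{\sum_{u}\prod_{v\in V}p^v(u_v)\,\delta_{x_v,\,f^v(x_{\mathrm{Pa}(v)},u_v)}}{\sum_{y}\sum_{u}\prod_{v\in V}p^v(u_v)\,\delta_{y_v,\,f^v(y_{\mathrm{Pa}(v)},u_v)}}$$ for every global event $x=\{x_v\in\mathcal X_v\}_{v\in V}$, where $\sum_y$ runs over all $y=\{y_v\in\mathcal X_v\}_{v\in V}$ and $\sum_u$ over all $u=\{u_v\in\mathcal U_v\}_{v\in V}$.
   Context: Graphs. A directed graph $G=(V,E)$ has a finite vertex set $V$ and edges $E\subseteq V\times V$, $(v,w)$ being an edge from $v$ to $w$. $\mathrm{Pa}(v)=\{w:(w,v)\in E\}$, $\mathrm{Ch}(v)=\{w:(v,w)\in E\}$, $\mathrm{out}(v)=\{(v,w)\in E\}$. Finite functional causal model (fCM) on $G$. To each $v\in V$ assign: a random variable $X_v$ with values $x_v$ in a non-empty finite set $\mathcal X_v$; an error variable $U_v$ with values $u_v$ in a finite set $\mathcal U_v$ with probability distribution $p^v$ on $\mathcal U_v$; a function $f^v:\prod_{w\in \mathrm{Pa}(v)}\mathcal X_w\times\mathcal U_v\to\mathcal X_v$. If $G$ is acyclic, its distribution is $P_{\mathrm{acyc}}(x)_G=\sum_u\prod_{v\in V}p^v(u_v)\,\delta_{x_v,f^v(x_{\mathrm{Pa}(v)},u_v)}$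 for $x=\{x_v\}_{v\in V}$, the sum being over all $u=\{u_v\in\mathcal U_v\}_{v\in V}$. Classical post-selected teleportation protocol on a finite set $\mathcal X_A=\mathcal X_C$: a finite set $\mathcal X_B$, a function $g:\mathcal X_A\times\mathcal X_B\times\mathcal X_C\to\{0,1\}$ and probability distributions $q_B$ on $\mathcal X_B$, $q_C$ on $\mathcal X_C$ such that for all probability distributions $p^A$ on $\mathcal X_A$ and all $c\in\mathcal X_C$, $\sum_{a,b}p^A(a)\,\delta_{g(a,b,c),1}\,q_B(b)\,q_C(c)=p_{\mathrm{tele}}\,p^A(c)$, where $p_{\mathrm{tele}}\in(0,1]$ (independent of $p^A$) is the success probability. Teleportation graphs. The family $\mathcal G_{\mathrm{tele}}(G)$ consists of all graphs $G_{\mathrm{t}}$ obtained thus: choose $S\subseteq V$ (''split vertices'') such that $(V,E')$ with $E'=E\setminus\bigcup_{v\in S}\mathrm{out}(v)$ is acyclic. The vertices of $G_{\mathrm t}$ are $V\cup\{R_v\}_{v\in S}\cup\{T_v\}_{v\in S}$ with new vertices $R_v$ (pre-selection) and $T_v$ (post-selection). The edges are $E'\cup\{(v,T_v),(R_v,T_v)\}_{v\in S}\cup\{(R_v,w): v\in S,\ w\in\mathrm{Ch}(v)\text{ in }G\}$. All such $G_{\mathrm t}$ are acyclic. Teleportation models. Given an fCM on $G$ and $G_{\mathrm t}\in\mathcal G_{\mathrm{tele}}(G)$, a classical teleportation model on $G_{\mathrm t}$ is an fCM in which: for each $v\in S$, $T_v$ takes values $t_v\in\{0,1\}$, $R_v$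 takes values $r_v\in\mathcal X_v$ and equals its error variable, and the function $f^{T_v}$ with the error distributions $p^{T_v},p^{R_v}$ form a classical post-selected teleportation protocol ($g=f^{T_v}$ with arguments the value of $v$, the error of $T_v$, and the value of $R_v$; $q_B=p^{T_v}$, $q_C=p^{R_v}$); every $w\in V$ keeps the same sets, error variable and function as in the fCM on $G$, where $r_v$ replaces $x_v$ as an input for each $v\in S\cap \mathrm{Pa}(w)$ (parents in $G$). Probabilities in $G$. For a teleportation model on $G_{\mathrm t}$ let $P_{\mathrm{succ}}=P_{\mathrm{acyc}}(\{t_v=1\}_{v\in S})_{G_{\mathrm t}}$. If $P_{\mathrm{succ}}>0$ the distribution of the fCM on $G$ is defined as $P(x)_G:=P_{\mathrm{acyc}}(x\mid\{t_v=1\}_{v\in S})_{G_{\mathrm t}}$ for $x=\{x_v\in\mathcal X_v\}_{v\in V}$ (values of $R_v$ marginalized). If $P_{\mathrm{succ}}=0$ the model is called inconsistent and $P(\cdot)_G$ is undefined. *)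

(* Defs.v *)
From HB Require Import structures.
From mathcomp Require Import all_boot all_order all_algebra.

Set Implicit Arguments.
Unset Strict Implicit.
Unset Printing Implicit Defensive.

Import Order.TTheory GRing.Theory Num.Theory.
Local Open Scope ring_scope.

(** * Directed graphs *)

Record digraph := Digraph {
  vertex :> finType;
  edges : {set vertex * vertex} }.

Definition Pa (G : digraph) (v : G) : {set G} := [set w | (w, v) \in edges G].
Definition Ch (G : digraph) (v : G) : {set G} := [set w | (v, w) \in edges G].
Definition out (G : digraph) (v : G) : {set G * G} :=
  [set e in edges G | e.1 == v].

(** There is no non-empty closed walk; a self-loop at [v] is the closed walk
    [[:: v]]. *)
Definition acyclic (G : digraph) : Prop :=
  forall s : seq G, cycle (fun v w => (v, w) \in edges G) s -> s = [::].

(** * Finite functional causal models *)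

Definition is_distr (R : realFieldType) (T : finType) (p : T -> R) : Prop :=
  (forall t, 0 <= p t) /\ \sum_t p t = 1.

(** The argument of [fcm_fun m v] is a family of values indexed by the parents
    of [v] only. *)
Record fcm (R : realFieldType) (G : digraph) := Fcm {
  fcm_val : G -> finType;
  fcm_val_neq0 : forall v, (0 < #|fcm_val v|)%N;
  fcm_err : G -> finType;
  fcm_prob : forall v, fcm_err v -> R;
  fcm_prob_distr : forall v, is_distr (@fcm_prob v);
  fcm_fun : forall v,
    {dffun forall w : {w : G | w \in Pa v}, fcm_val (val w)} ->
    fcm_err v -> fcm_val v }.

Definition event (R : realFieldType) (G : digraph) (m : fcm R G) : finType :=
  {dffun forall v : G, fcm_val m v}.

Definition errors (R : realFieldType) (G : digraph) (m : fcm R G) : finType :=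
  {dffun forall v : G, fcm_err m v}.

Definition restr_Pa (R : realFieldType) (G : digraph) (m : fcm R G)
    (x : event m) (v : G) :
    {dffun forall w : {w : G | w \in Pa v}, fcm_val m (val w)} :=
  finfun (fun w : {w : G | w \in Pa v} => x (val w)).

(** When [G] is acyclic this is the probability of [x] in the model [m]. On a
    cyclic graph it is in general not normalised. *)
Definition fcm_weight (R : realFieldType) (G : digraph) (m : fcm R G)
    (x : event m) : R :=
  \sum_(u : errors m) \prod_(v : G)
    (fcm_prob (u v) * (x v == fcm_fun (restr_Pa x v) (u v))%:R).

(** The probability, on an acyclic graph, of a set of global events. *)
Definition fcm_Pr (R : realFieldType) (G : digraph) (m : fcm R G)
    (A : {set event m}) : R :=
  \sum_(x in A) fcm_weight x.

(** * Classical post-selected teleportation protocols *)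

Record protocol (R : realFieldType) (XA : finType) := Protocol {
  tele_aux : finType;
  tele_test : XA -> tele_aux -> XA -> bool;
  tele_qB : tele_aux -> R;
  tele_qC : XA -> R;
  tele_prob : R;
  tele_qB_distr : is_distr tele_qB;
  tele_qC_distr : is_distr tele_qC;
  tele_prob_itv : 0 < tele_prob <= 1;
  tele_correct : forall pA : XA -> R, is_distr pA -> forall c : XA,
    \sum_(a : XA) \sum_(b : tele_aux)
      pA a * (tele_test a b c == true)%:R * tele_qB b * tele_qC c
    = tele_prob * pA c }.

(** * Teleportation graphs *)

Definition unsplit_graph (G : digraph) (S : {set G}) : digraph :=
  @Digraph G (edges G :\: \bigcup_(v in S) out v).

Definition is_split (G : digraph) (S : {set G}) : Prop :=
  acyclic (unsplit_graph S).

Notation split_vertex S := {v | v \in S}.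

Definition tele_vertex (G : digraph) (S : {set G}) : finType :=
  (G + split_vertex S + split_vertex S)%type.

Definition orig_vertex (G : digraph) (S : {set G}) (v : G) : tele_vertex S :=
  inl (inl v).
(** The pre-selection vertex R_v. *)
Definition pre_vertex (G : digraph) (S : {set G}) (s : split_vertex S) :
  tele_vertex S := inl (inr s).
(** The post-selection vertex T_v. *)
Definition post_vertex (G : digraph) (S : {set G}) (s : split_vertex S) :
  tele_vertex S := inr s.

Definition tele_edge (G : digraph) (S : {set G}) (a b : tele_vertex S) : bool :=
  match a, b with
  | inl (inl v), inl (inl w) => (v, w) \in edges (unsplit_graph S)
  | inl (inl v), inr s => v == val s
  | inl (inr r), inr s => r == s
  | inl (inr r), inl (inl w) => w \in Ch (val r)
  | _, _ => false
  end.

Definition tele_graph (G : digraph) (S : {set G}) : digraph :=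
  @Digraph (tele_vertex S) [set e | tele_edge e.1 e.2].

Lemma orig_Pa_post (G : digraph) (S : {set G}) (s : split_vertex S) :
  orig_vertex S (val s) \in @Pa (tele_graph S) (post_vertex s).
Proof. by rewrite !inE /=. Qed.

Lemma pre_Pa_post (G : digraph) (S : {set G}) (s : split_vertex S) :
  pre_vertex s \in @Pa (tele_graph S) (post_vertex s).
Proof. by rewrite !inE /=. Qed.

Lemma pre_Pa_orig (G : digraph) (S : {set G}) (w v : G) (vS : v \in S) :
  v \in Pa w ->
  pre_vertex (exist _ v vS) \in @Pa (tele_graph S) (orig_vertex S w).
Proof. by rewrite !inE /= inE. Qed.

Lemma orig_Pa_orig (G : digraph) (S : {set G}) (w v : G) : v \notin S ->
  v \in Pa w -> orig_vertex S v \in @Pa (tele_graph S) (orig_vertex S w).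
Proof.
move=> vS; rewrite !inE /= !inE => ->; rewrite andbT.
by apply/bigcupP => -[z zS]; rewrite inE /= => /andP[_ /eqP vz];
  rewrite vz zS in vS.
Qed.

(** * Teleportation models *)

(** All the data of a teleportation model that is not already fixed by the
    model [m] on [G]: a protocol for each split vertex. *)
Definition tele_model (R : realFieldType) (G : digraph) (m : fcm R G)
    (S : {set G}) := forall s : split_vertex S, protocol R (fcm_val m (val s)).

Section TeleportationFcm.
Variables (R : realFieldType) (G : digraph) (m : fcm R G) (S : {set G}).
Variable M : tele_model m S.

Definition tele_val (a : tele_graph S) : finType :=
  match a with
  | inl (inl v) => fcm_val m v
  | inl (inr s) => fcm_val m (val s)
  | inr _ => bool
  end.

Lemma tele_val_neq0 a : (0 < #|tele_val a|)%N.
Proof. by case: a => [[v|s]|s] /=; rewrite ?card_bool ?fcm_val_neq0. Qed.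

Definition tele_err (a : tele_graph S) : finType :=
  match a with
  | inl (inl v) => fcm_err m v
  | inl (inr s) => fcm_val m (val s)
  | inr s => tele_aux (M s)
  end.

Definition tele_err_prob (a : tele_graph S) : tele_err a -> R :=
  match a with
  | inl (inl v) => @fcm_prob R G m v
  | inl (inr s) => @tele_qC _ _ (M s)
  | inr s => @tele_qB _ _ (M s)
  end.

Lemma tele_err_prob_distr a : is_distr (@tele_err_prob a).
Proof.
case: a => [[v|s]|s] /=; first exact: fcm_prob_distr.
- exact: tele_qC_distr.
- exact: tele_qB_distr.
Qed.

Definition tele_input (a : tele_graph S) : finType :=
  {dffun forall b : {b : tele_graph S | b \in Pa a}, tele_val (val b)}.

(** The input of [w] in [G], in which the value of R_v replaces the value of
    [v] for every split parent [v] of [w]. *)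
Definition tele_orig_input (w : G) (y : tele_input (orig_vertex S w)) :
    {dffun forall v : {v : G | v \in Pa w}, fcm_val m (val v)} :=
  finfun (fun v : {v : G | v \in Pa w} =>
    match boolP (val v \in S) with
    | AltTrue vS =>
        y (exist _ (pre_vertex (exist _ (val v) vS)) (pre_Pa_orig vS (valP v)))
    | AltFalse vS =>
        y (exist _ (orig_vertex S (val v)) (orig_Pa_orig vS (valP v)))
    end).

Definition tele_fun (a : tele_graph S) :
    tele_input a -> tele_err a -> tele_val a :=
  match a with
  | inl (inl w) => fun y u => fcm_fun (tele_orig_input y) u
  | inl (inr s) => fun _ u => u
  | inr s => fun y u =>
      tele_test (y (exist _ (orig_vertex S (val s)) (orig_Pa_post s))) u
                (y (exist _ (pre_vertex s) (pre_Pa_post s)))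
  end.

Definition tele_fcm : fcm R (tele_graph S) :=
  Fcm tele_val_neq0 tele_err_prob_distr tele_fun.

(** * Probabilities in a possibly cyclic graph *)

Definition success : {set event tele_fcm} :=
  [set z : event tele_fcm | [forall s : split_vertex S, z (post_vertex s) == true]].

Definition P_succ : R := fcm_Pr success.

(** The values of the vertices R_v are marginalised. *)
Definition orig_event (x : event m) : {set event tele_fcm} :=
  [set z : event tele_fcm | [forall v : G, z (orig_vertex S v) == x v]].

(** Meaningful only when [P_succ] is positive. *)
Definition tele_distr (x : event m) : R :=
  fcm_Pr (orig_event x :&: success) / P_succ.

Definition inconsistent : Prop := P_succ = 0.

End TeleportationFcm.

(* Main.v *)
(** Exchanging the sum over errors with the product over vertices turns the
    weight of an event into a product of local kernels.  Feeding point masses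
    to a protocol gives [sum_b q_B(b) q_C(c) [g(a,b,c)=1] = p_tele [a=c]], so
    on success the kernels of R_v and T_v multiply to [p_tele] times the
    indicator that R_v and v agree.  Each event [x] of [G] therefore has a
    single successful extension of possibly nonzero weight, the one copying [x]
    on the R_v, and its weight is that of [x] times the product of the success
    probabilities, a factor that cancels in the conditional distribution. *)
Require Import Defs.
From HB Require Import structures.
From mathcomp Require Import all_boot all_order all_algebra.

Set Implicit Arguments.
Unset Strict Implicit.
Unset Printing Implicit Defensive.

Import Order.TTheory GRing.Theory Num.Theory.
Local Open Scope ring_scope.

(** [bigA_distr_big_dep] sums over functions into one fixed type, so the terms pass through the
    tagged union of the [T i]. *)
Lemma prod_sum_dffun (R : comPzSemiRingType) (I : finType) (T : I -> finType)
    (F : forall i, T i -> R) :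
  \prod_i \sum_(t : T i) F i t =
  \sum_(u : {dffun forall i, T i}) \prod_i F i (u i).
Proof.
pose P i := [ffun t : T i => F i t].
transitivity (\prod_i \sum_(j in tagged_with T i) untag 0 (P i) j).
  apply: eq_bigr => i _; rewrite -(big_tag (fun i => P i)).
  by apply: eq_bigr => t _; rewrite ffunE.
rewrite bigA_distr_big_dep -(big_fprod 1 _ P).
rewrite (reindex (@dffun_of_fprod I T)); last exact/onW_bij/dffun_of_fprod_bij.
by apply: eq_bigr => u _; apply: eq_bigr => i _; rewrite !ffunE.
Qed.

(** The Markov kernel of [v] given its parents. *)
Definition kernel (R : realFieldType) (G : digraph) (m : fcm R G)
    (x : event m) (v : G) : R :=
  \sum_(t : fcm_err m v) fcm_prob t * (x v == fcm_fun (restr_Pa x v) t)%:R.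

Lemma fcm_weight_prod (R : realFieldType) (G : digraph) (m : fcm R G)
    (x : event m) : fcm_weight x = \prod_v kernel x v.
Proof. by rewrite prod_sum_dffun. Qed.

Lemma protocol_delta (R : realFieldType) (XA : finType) (P : protocol R XA)
    (a c : XA) :
  \sum_(b : tele_aux P) tele_qB b * (tele_test a b c)%:R * tele_qC P c =
  tele_prob P * (c == a)%:R.
Proof.
have dlt : is_distr (fun x : XA => (x == a)%:R : R).
  split=> [x|]; first exact: ler0n.
  by rewrite (bigD1 a) //= eqxx big1 ?addr0 // => x /negPf ->.
rewrite -(tele_correct P dlt) (bigD1 a) //= [X in _ + X]big1 ?addr0.
  by apply: eq_bigr => b _; rewrite eqxx mul1r eqb_id (mulrC (tele_qB b)).
by move=> x /negPf xa; apply: big1 => b _; rewrite xa !mul0r.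
Qed.

Section Teleportation.
Variables (R : realFieldType) (G : digraph) (m : fcm R G) (S : {set G}).
Variable M : tele_model m S.
Local Notation E := (event (tele_fcm M)).

Definition proj_event (z : E) : event m :=
  finfun (fun v : G => z (orig_vertex S v) : fcm_val m v).

Definition lift_event (x : event m) : E :=
  finfun (fun a : tele_graph S =>
    match a return tele_val m a with
    | inl (inl v) => x v
    | inl (inr s) => x (val s)
    | inr _ => true
    end).

Definition agree (z : E) : bool :=
  [forall s : split_vertex S,
     (z (pre_vertex s) : fcm_val m (val s)) == z (orig_vertex S (val s))].

(** R_v equals its error variable, so its kernel is [tele_qC]; multiplied by the kernel of T_v at
    [true], it gives the left side of [protocol_delta]. *)
Lemma kernel_pre_post (z : E) (s : split_vertex S) : z \in success M ->
  kernel z (pre_vertex s) * kernel z (post_vertex s) =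
  tele_prob (M s) *
  ((z (pre_vertex s) : fcm_val m (val s)) == z (orig_vertex S (val s)))%:R.
Proof.
rewrite inE => /forallP /(_ s) /eqP zs.
have -> : kernel z (pre_vertex s) = tele_qC (M s) (z (pre_vertex s)).
  rewrite /kernel /= (bigD1 (z (pre_vertex s))) //= eqxx mulr1 big1 ?addr0 //.
  by move=> t; rewrite eq_sym => /negPf ->; rewrite mulr0.
rewrite -protocol_delta /kernel mulr_sumr; apply: eq_bigr => b _ /=.
by rewrite zs /restr_Pa !ffunE /= eq_sym eqb_id mulrC.
Qed.

(** Only inputs from split parents differ: they arrive through R_w, which [agree] identifies with
    w. *)
Lemma kernel_orig (z : E) (v : G) : agree z ->
  kernel z (orig_vertex S v) = kernel (proj_event z) v.
Proof.
move=> /forallP ag.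
have inputE : tele_orig_input (restr_Pa z (orig_vertex S v)) =
              restr_Pa (proj_event z) v.
  apply/ffunP => w; rewrite !ffunE.
  (* The pattern abstracts only the index of [boolP], which the branches need. *)
  by case: {-}_ / boolP => wS; rewrite !ffunE //=; apply/eqP/(ag (exist _ (val w) wS)).
by apply: eq_bigr => t _ /=; rewrite inputE ffunE.
Qed.

Definition total_tele_prob : R := \prod_(s : split_vertex S) tele_prob (M s).

Lemma weight_success (z : E) : z \in success M ->
  fcm_weight z = (agree z)%:R * (total_tele_prob * fcm_weight (proj_event z)).
Proof.
(* Three blocks of vertices; those of the R_v and the T_v merge into one product over [S]. *)
move=> zs; rewrite !fcm_weight_prod big_sumType big_sumType /= -mulrA -big_split.
rewrite (eq_bigr _ (fun s _ => kernel_pre_post s zs)) big_split /=.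
case: (boolP (agree z)) => [ag | /forallPn [s /negPf ns]].
  rewrite [X in _ * (_ * X) = _]big1 => [|s _]; last by rewrite (forallP ag s).
  rewrite mulr1 mul1r mulrC; congr (_ * _).
  by apply: eq_bigr => v _; apply: kernel_orig.
rewrite mul0r [X in _ * (_ * X) = _](bigD1 s) //= ns.
by rewrite mul0r !mulr0.
Qed.

Lemma orig_eventE (x : event m) (z : E) :
  (z \in orig_event M x) = (proj_event z == x).
Proof.
rewrite inE; apply/forallP/eqP => [zx | <- v]; last by rewrite ffunE.
by apply/ffunP => v; rewrite ffunE; apply/eqP/zx.
Qed.

(** The three conditions fix [z] on the original vertices, the T_v and the R_v respectively. *)
Lemma lift_eventP (x : event m) (z : E) :
  reflect (z = lift_event x)
    [&& z \in orig_event M x, z \in success M & agree z].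
Proof.
apply: (iffP and3P) => [[] | ->]; rewrite !inE.
  move=> /forallP zo /forallP zp /forallP ag; apply/ffunP => -[[v|s]|s].
  - by rewrite ffunE; apply/eqP/zo.
  - by rewrite ffunE; rewrite (eqP (ag s)); apply/eqP/zo.
  - by rewrite ffunE; apply/eqP/zp.
by split; apply/forallP => s; rewrite !ffunE.
Qed.

Lemma Pr_orig_success (x : event m) :
  fcm_Pr (orig_event M x :&: success M) = total_tele_prob * fcm_weight x.
Proof.
have /and3P[lo ls la] := introT (lift_eventP x _) erefl.
rewrite /fcm_Pr (bigD1 (lift_event x)) /=; last by rewrite inE lo.
rewrite weight_success // la mul1r.
move: lo; rewrite orig_eventE => /eqP ->; rewrite big1 ?addr0 //.
move=> z; rewrite inE -andbA => /and3P[zo zs nz]; rewrite weight_success //.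
(* Any other [z] has weight zero by disagreement, or else would be the lift itself. *)
case: (boolP (agree z)) => ag; last by rewrite mul0r.
by case/eqP: nz; apply/lift_eventP/and3P.
Qed.

(** Sum [Pr_orig_success] over the fibres of [proj_event]. *)
Lemma P_succE : P_succ M = total_tele_prob * \sum_(y : event m) fcm_weight y.
Proof.
rewrite mulr_sumr /P_succ /fcm_Pr (partition_big proj_event predT) //=.
apply: eq_bigr => x _; rewrite -Pr_orig_success.
by apply: eq_bigl => z; rewrite in_setI orig_eventE andbC.
Qed.

End Teleportation.

Theorem proposition2 (R : realFieldType) (G : digraph) (m : fcm R G)
    (S : {set G}) (S_split : is_split S) (M : tele_model m S)
    (M_consistent : ~ inconsistent M) :
  \sum_(y : event m) fcm_weight y != 0 /\
  forall x : event m,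
    tele_distr M x = fcm_weight x / \sum_(y : event m) fcm_weight y.
Proof.
have: P_succ M != 0 by apply/eqP.
(* Consistency makes both factors nonzero: the one to cancel and the denominator. *)
rewrite P_succE mulf_eq0 negb_or => /andP[p0 w0]; split=> // x.
by rewrite /tele_distr Pr_orig_success P_succE -mulf_div divff ?mul1r.
Qed.
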